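(* $C_{\mathrm{NICF}} \subseteq \mathrm{NICF}_5^* \setminus \mathbb{Q}$.
   Context: NICF expansion: for real $x$, set $x_0=x$, $a_i=\lfloor x_i\rceil$ (nearest integer), $x_{i+1}=1/(x_i-a_i)$ while $x_i\ne a_i$; $x=[a_0;a_1,a_2,\ldots]$. $\mathrm{NICF}_5^*\setminus\mathbb{Q}$ is the set of irrational $x\in[0,1]$ whose NICF expansion satisfies, for all $i\ge1$: $|a_i|\le 5$, and if $|a_i|=5$ then $a_{i+1}$ has sign opposite to $a_i$. Notation: for integers $a_0,\ldots,a_n$ and real $z$, $[a_0;a_1,\ldots,a_n:z]$ denotes $a_0+\cfrac{1}{a_1+\cfrac{1}{\ddots+\cfrac{1}{a_n+\frac1z}}}$ (for $n=0$: $a_0+1/z$). Let $\mu=\frac{5+\sqrt{21}}{2}$. For a finite integer sequence $\bar a=(a_0,\ldots,a_n)$ and integer $k$ put $P_{k^+}(\bar a)=[a_0;a_1,\ldots,a_n,k:\mu]$ and $P_{k^-}(\bar a)=[a_0;a_1,\ldots,a_n,k:-\mu]$, and let $T_{u,v}(\bar a)$ be the closed interval with endpoints $P_{u^+}(\bar a)$ and $P_{v^-}(\bar a)$. Let $T_{0,1}=[1/\mu,\,1-1/\mu]$. The Cantor set $C_{\mathrm{NICF}}$ is constructed from the initial interval $T_{0,1}$ by repeatedly removing an open gap from each interval, the two closed pieces that remain being the next intervals, according to the rules (where $(\bar a,b)$ denotes $\bar a$ with $b$ appended): (1) $T_{0,1}$: gap is the open interval between $[0;2:\mu]$ and $[1;-2:-\mu]$;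 remaining intervals $T_{2,5}((0))$ and $T_{-5,-2}((1))$. (2) $T_{b,b+1}(\bar a)$ with $b\in\{-5,-4,-3,2,3,4\}$: gap between $P_{2^+}((\bar a,b))$ and $P_{-2^-}((\bar a,b+1))$; remaining $T_{2,5}((\bar a,b))$ and $T_{-5,-2}((\bar a,b+1))$. (3) $T_{2,5}(\bar a)$: gap between $P_{3^-}(\bar a)$ and $P_{3^+}(\bar a)$; remaining $T_{2,3}(\bar a)$, $T_{3,5}(\bar a)$. (4) $T_{3,5}(\bar a)$: gap between $P_{4^-}(\bar a)$ and $P_{4^+}(\bar a)$; remaining $T_{3,4}(\bar a)$, $T_{4,5}(\bar a)$. (5) $T_{-5,-2}(\bar a)$: gap between $P_{-3^-}(\bar a)$ and $P_{-3^+}(\bar a)$; remaining $T_{-5,-3}(\bar a)$, $T_{-3,-2}(\bar a)$. (6) $T_{-5,-3}(\bar a)$: gap between $P_{-4^-}(\bar a)$ and $P_{-4^+}(\bar a)$; remaining $T_{-5,-4}(\bar a)$, $T_{-4,-3}(\bar a)$. In each case the gap lies inside the interval and the interval is the disjoint union of the gap and the two remaining intervals. Let $\mathcal{F}$ be the family of intervals obtained from $T_{0,1}$ by iterating these rules; then $C_{\mathrm{NICF}}=T_{0,1}\setminus\bigcup_{I\in\mathcal{F}}(\text{gap of }I)$. *)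

(* Defs.v *)
From HB Require Import structures.
From mathcomp Require Import all_boot all_order all_algebra.
From mathcomp Require Import all_classical all_reals.

Set Implicit Arguments.
Unset Strict Implicit.
Unset Printing Implicit Defensive.

Import Order.TTheory GRing.Theory Num.Theory.

Local Open Scope classical_set_scope.
Local Open Scope ring_scope.

Section NICF.
Variable R : realType.
Implicit Types (x z p q : R) (a b k u v : int) (s : seq int).

(* Ties are rounded up; they never occur in the expansion of an irrational. *)
Definition nearest_int x : int := Num.floor (x + 2^-1).

(* [nicf_tail x i] is x_i and [nicf_digit x i] is a_i; both are [None] once
   the expansion has terminated. *)
Fixpoint nicf_tail x (i : nat) : option R :=
  if i is j.+1 then
    if nicf_tail x j is Some y then
      if y == (nearest_int y)%:~R then None
      else Some (1 / (y - (nearest_int y)%:~R))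
    else None
  else Some x.

Definition nicf_digit x (i : nat) : option int :=
  omap nearest_int (nicf_tail x i).

(* The conditions bear on the digits that exist; by [nicf_digit_irrational]
   below, all of them do when x is irrational. *)
Definition NICF5star : set R := [set x | 0 <= x <= 1 /\
  forall (i : nat) a, (1 <= i)%N -> nicf_digit x i = Some a ->
    `|a| <= 5 /\
    (`|a| = 5 -> forall b, nicf_digit x i.+1 = Some b -> sgz b = - sgz a)].

(* [cf [:: a_0; ...; a_n] z] is [a_0; a_1, ..., a_n : z]. *)
Fixpoint cf s z : R :=
  if s is a :: s' then a%:~R + 1 / cf s' z else z.

Definition mu : R := (5 + Num.sqrt 21) / 2.

Definition Pplus k s : R := cf (rcons s k) mu.
Definition Pminus k s : R := cf (rcons s k) (- mu).

(* The endpoints are given in no particular order: which one is the smaller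
   depends on the parity of the length of the continued fraction. *)
Definition cinterval p q : set R :=
  [set x | Num.min p q <= x <= Num.max p q].
Definition ointerval p q : set R :=
  [set x | Num.min p q < x < Num.max p q].

Inductive interval_name := T01 | T of int & int & seq int.

Definition interval_set (I : interval_name) : set R :=
  match I with
  | T01 => cinterval (1 / mu) (1 - 1 / mu)
  | T u v s => cinterval (Pplus u s) (Pminus v s)
  end.

(* [splits I p q J K]: the gap of I is the open interval between p and q, and
   J, K are the two closed intervals that remain. *)
Inductive splits :
    interval_name -> R -> R -> interval_name -> interval_name -> Prop :=
| splits_T01 :
    splits T01 (cf [:: 0; 2] mu) (cf [:: 1; -2] (- mu))
      (T 2 5 [:: 0]) (T (-5) (-2) [:: 1])
| splits_succ b s of b \in [:: -5; -4; -3; 2; 3; 4] :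
    splits (T b (b + 1) s)
      (Pplus 2 (rcons s b)) (Pminus (-2) (rcons s (b + 1)))
      (T 2 5 (rcons s b)) (T (-5) (-2) (rcons s (b + 1)))
| splits_2_5 s :
    splits (T 2 5 s) (Pminus 3 s) (Pplus 3 s) (T 2 3 s) (T 3 5 s)
| splits_3_5 s :
    splits (T 3 5 s) (Pminus 4 s) (Pplus 4 s) (T 3 4 s) (T 4 5 s)
| splits_m5_m2 s :
    splits (T (-5) (-2) s) (Pminus (-3) s) (Pplus (-3) s)
      (T (-5) (-3) s) (T (-3) (-2) s)
| splits_m5_m3 s :
    splits (T (-5) (-3) s) (Pminus (-4) s) (Pplus (-4) s)
      (T (-5) (-4) s) (T (-4) (-3) s).

Inductive nicf_family : interval_name -> Prop :=
| nicf_family_T01 : nicf_family T01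
| nicf_family_fst I p q J K of nicf_family I & splits I p q J K : nicf_family J
| nicf_family_snd I p q J K of nicf_family I & splits I p q J K : nicf_family K.

Definition gap (I : interval_name) : set R :=
  [set x | exists p q J K, splits I p q J K /\ ointerval p q x].

Definition C_NICF : set R :=
  interval_set T01 `\` \bigcup_(I in nicf_family) gap I.

Lemma nicf_digit_irrational x (i : nat) :
  irrational x -> exists a, nicf_digit x i = Some a.
Proof.
move=> xQ.
suff [y yE _] : exists2 y, nicf_tail x i = Some y & irrational y.
  by exists (nearest_int y); rewrite /nicf_digit yE.
elim: i => [|i [y yE yQ]]; first by exists x.
have y_neq : y != (nearest_int y)%:~R.
  apply/eqP => yz; apply: yQ; exists (nearest_int y)%:~R => //.
  by rewrite ratr_int -yz.
exists (1 / (y - (nearest_int y)%:~R)); first by rewrite /= yE (negPf y_neq).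
move=> [r _ rE]; apply: yQ; exists (r^-1 + (nearest_int y)%:~R) => //.
by rewrite rmorphD fmorphV /= ratr_int rE div1r invrK subrK.
Qed.

End NICF.

Arguments NICF5star R : clear implicits.
Arguments C_NICF R : clear implicits.
Arguments mu {R}.

(* Main.v *)
Require Import Defs.
From mathcomp Require Import all_boot all_order all_algebra.
From mathcomp Require Import all_classical all_reals.
From mathcomp Require Import lra zify.

(* A point of an interval that avoids the gaps of all its descendants lies in
   one of the two pieces at every splitting, and dropping the first digit [b] of
   a name, i.e. writing [x = b + 1 / y], carries the tree of intervals below
   T_{2,5}((b)) (resp. T_{-5,-2}((b))) to the tree below T_{2,5} (resp.
   T_{-5,-2}) with empty prefix. So only the empty prefix has to be inspected:
   since [mu = 5 - 1 / mu], a surviving tail [x] lies in [2 + 1/mu, mu] or its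
   opposite, within 1/2 of a digit [b] with [2 <= |b| <= 5], and
   [1 / (x - b)] survives again, with sign opposite to [b] if [|b| = 5]. Hence
   the NICF expansion is read off the nested intervals and never terminates,
   which also excludes rational points. *)

Set Implicit Arguments.
Unset Strict Implicit.
Unset Printing Implicit Defensive.

Import Order.TTheory GRing.Theory Num.Theory.

Local Open Scope classical_set_scope.
Local Open Scope ring_scope.

Section Survivors.
Variable R : realType.
Implicit Types (x y z p q : R) (a b e u v : int) (s : seq int).
Implicit Types (I J K : interval_name).

Local Notation m := (1 / @mu R).

(** * Numerical facts about [mu] *)

Lemma sqrt21_bounds : 456 / 100 < Num.sqrt (21 : R) < 459 / 100.
Proof.
have s0 : 0 <= Num.sqrt (21 : R) by apply: sqrtr_ge0.
have s2 : Num.sqrt (21 : R) * Num.sqrt 21 = 21 by rewrite -expr2 sqr_sqrtr.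
by apply/andP; split; rewrite ltNge; apply/negP => ?; nra.
Qed.

Lemma mu_inv_bounds : 1 / 5 < m < 21 / 100.
Proof.
have /andP[s1 s2] := sqrt21_bounds.
have mu0 : 0 < @mu R by rewrite /mu; lra.
by rewrite ltr_pdivlMr // [X in _ && X]ltr_pdivrMr // /mu; lra.
Qed.

Lemma mu_eq : @mu R = 5 - m.
Proof.
have s2 : Num.sqrt (21 : R) * Num.sqrt 21 = 21 by rewrite -expr2 sqr_sqrtr.
have mu0 : @mu R != 0 by rewrite gt_eqF // /mu; have := sqrt21_bounds; lra.
by apply: (mulIf mu0); rewrite mulrBl divfK // /mu; lra.
Qed.

Lemma inv_oppmu : 1 / (- mu) = - m :> R.
Proof. by rewrite invrN mulrN. Qed.

(** As [mu] is a root of t^2 - 5 t + 1, the expansion [5 : -mu] is [mu] itself. This is what makes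
    the extreme endpoints of the intervals match after a digit is dropped. *)
Lemma digit5_mu : 5%:~R - m = mu :> R.
Proof. by have := mu_eq; lra. Qed.

Lemma digitm5_mu : (- 5 : int)%:~R + m = - mu :> R.
Proof. by have := mu_eq; lra. Qed.

Lemma digitm2_mu : (- 2 : int)%:~R - m = - (2 + m) :> R.
Proof. by lra. Qed.

Lemma inv_2mu_bounds : 45 / 100 < 1 / (2 + m) < 1 / 2.
Proof.
have := mu_inv_bounds => /andP[m1 m2].
have m0 : 0 < 2 + m by lra.
by rewrite ltr_pdivlMr // [X in _ && X]ltr_pdivrMr //; lra.
Qed.

(** * Intervals, and points that avoid every gap below them *)

Lemma cintervalP p q x : cinterval p q x <-> p <= x <= q \/ q <= x <= p.
Proof.
rewrite /cinterval /=; case: (leP p q) => pq; split=> [?|[]]; try lra.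
Qed.

Lemma ointervalP p q x : ointerval p q x <-> p < x < q \/ q < x < p.
Proof.
rewrite /ointerval /=; case: (leP p q) => pq; split=> [?|[]]; try lra.
Qed.

(** [nicf_family] is rooted at [T01] and never contains an interval with empty prefix. The tails of
    an expansion live in such intervals, so the root is made a parameter. *)
Inductive descendant I : interval_name -> Prop :=
| descendant_refl : descendant I I
| descendant_fst J p q K L of descendant I J & splits (R := R) J p q K L :
    descendant I K
| descendant_snd J p q K L of descendant I J & splits (R := R) J p q K L :
    descendant I L.

Lemma descendant_trans I J K :
  descendant I J -> descendant J K -> descendant I K.
Proof.
move=> IJ; elim=> // [K1 p q K2 K3 _ IH sp | K1 p q K2 K3 _ IH sp].
- exact: descendant_fst IH sp.
- exact: descendant_snd IH sp.
Qed.

Lemma descendant_family I : descendant T01 I -> nicf_family R I.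
Proof.
elim=> [|K1 p q K2 K3 _ IH sp | K1 p q K2 K3 _ IH sp].
- exact: nicf_family_T01.
- exact: nicf_family_fst IH sp.
- exact: nicf_family_snd IH sp.
Qed.

Definition survives I x :=
  interval_set I x /\ forall J, descendant I J -> ~ gap J x.

Lemma C_NICF_survives x : C_NICF R x -> survives T01 x.
Proof.
case=> xI xG; split=> // J /descendant_family JF xJ.
by apply: xG; exists J.
Qed.

Lemma survives_split I p q J K x : splits I p q J K ->
  (interval_set I x ->
    [\/ interval_set J x, ointerval p q x | interval_set K x]) ->
  survives I x -> survives J x \/ survives K x.
Proof.
move=> sp cover [xI xG].
have dJ : descendant I J by apply: descendant_fst sp; apply: descendant_refl.
have dK : descendant I K by apply: descendant_snd sp; apply: descendant_refl.
case: (cover xI) => [xJ|xpq|xK].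
- by left; split=> // L JL; apply: xG; apply: descendant_trans JL.
- by case: (xG _ (descendant_refl _)); exists p, q, J, K.
- by right; split=> // L KL; apply: xG; apply: descendant_trans KL.
Qed.

(** * Splittings at the top of the tree *)

Lemma survives_T01 x : survives T01 x ->
  survives (T 2 5 [:: 0]) x \/ survives (T (-5) (-2) [:: 1]) x.
Proof.
apply: survives_split (splits_T01 R) _.
have := mu_inv_bounds; have := inv_2mu_bounds; have := mu_eq.
rewrite /interval_set /Pplus /Pminus /= !inv_oppmu.
rewrite digitm2_mu digitm5_mu digit5_mu.
rewrite !invrN !mulrN.
(* In terms of w = 1 / mu and k = 1 / (2 + w) everything is linear: the pieces are [w, k] and
   [1 - k, 1 - w]. *)
set k := 1 / (2 + m); move: m k => w k muE kb wb /cintervalP xT.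
have [h|h] := leP x k; first by apply: Or31; apply/cintervalP; lra.
have [h'|h'] := ltP x (1 - k); first by apply: Or32; apply/ointervalP; lra.
by apply: Or33; apply/cintervalP; lra.
Qed.

(** T_{b,b+1} with empty prefix is the translate of T_{0,1} by [b], gap and pieces included. *)
Lemma survives_succ b x : b \in [:: -5; -4; -3; 2; 3; 4] ->
  survives (T b (b + 1) [::]) x ->
  survives (T 2 5 [:: b]) x \/ survives (T (-5) (-2) [:: b + 1]) x.
Proof.
move=> bin; apply: survives_split (splits_succ R [::] bin) _.
have := mu_inv_bounds; have := inv_2mu_bounds; have := mu_eq.
rewrite /interval_set /Pplus /Pminus /= !inv_oppmu.
rewrite digitm2_mu digitm5_mu digit5_mu.
rewrite !invrN !mulrN intrD.
set k := 1 / (2 + m); move: m k => w k muE kb wb /cintervalP xT.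
have [h|h] := leP x (b%:~R + k); first by apply: Or31; apply/cintervalP; lra.
have [h'|h'] := ltP x (b%:~R + 1 - k).
  by apply: Or32; apply/ointervalP; lra.
by apply: Or33; apply/cintervalP; lra.
Qed.

Lemma survives_middle u v c x :
  splits (T u v [::]) (Pminus R c [::]) (Pplus R c [::])
    (T u c [::]) (T c v [::]) ->
  u < c < v -> survives (T u v [::]) x ->
  survives (T u c [::]) x \/ survives (T c v [::]) x.
Proof.
move=> sp /andP[uc cv]; apply: survives_split sp _.
have := mu_inv_bounds.
rewrite /interval_set /Pplus /Pminus /= !inv_oppmu.
(* The gap is (c - w, c + w) with 2 w < 1, so integer distances of at least 1 put it strictly inside
   the interval. *)
have : (u + 1)%:~R <= c%:~R :> R by rewrite ler_int; lia.
have : (c + 1)%:~R <= v%:~R :> R by rewrite ler_int; lia.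
rewrite !intrD; move: m => w cv' uc' wb /cintervalP xT.
have [h|h] := leP x (c%:~R - w); first by apply: Or31; apply/cintervalP; lra.
have [h'|h'] := ltP x (c%:~R + w); first by apply: Or32; apply/ointervalP; lra.
by apply: Or33; apply/cintervalP; lra.
Qed.

(** Digit 5 only arises as the upper end of T_{4,5}, with x below it, so the next tail is negative:
    this is the origin of the sign rule. *)
Lemma survives_pos x : survives (T 2 5 [::]) x -> exists b,
  (2 <= b <= 4 /\ survives (T 2 5 [:: b]) x) \/
  (3 <= b <= 5 /\ survives (T (-5) (-2) [:: b]) x).
Proof.
suff E b : 2 <= b <= 4 -> survives (T b (b + 1) [::]) x -> exists b,
    (2 <= b <= 4 /\ survives (T 2 5 [:: b]) x) \/
    (3 <= b <= 5 /\ survives (T (-5) (-2) [:: b]) x).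
  case/(survives_middle (splits_2_5 R [::]))=> //; first exact: (E 2).
  case/(survives_middle (splits_3_5 R [::]))=> //; first exact: (E 3).
  exact: (E 4).
move=> bb; case/survives_succ => [|h|h]; first by rewrite !inE; lia.
- by exists b; left.
- by exists (b + 1); right; split=> //; lia.
Qed.

Lemma survives_neg x : survives (T (-5) (-2) [::]) x -> exists b,
  (-5 <= b <= -3 /\ survives (T 2 5 [:: b]) x) \/
  (-4 <= b <= -2 /\ survives (T (-5) (-2) [:: b]) x).
Proof.
suff E b : -5 <= b <= -3 -> survives (T b (b + 1) [::]) x -> exists b,
    (-5 <= b <= -3 /\ survives (T 2 5 [:: b]) x) \/
    (-4 <= b <= -2 /\ survives (T (-5) (-2) [:: b]) x).
  case/(survives_middle (splits_m5_m2 R [::]))=> //; last exact: (E (-3)).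
  case/(survives_middle (splits_m5_m3 R [::]))=> //; first exact: (E (-5)).
  exact: (E (-4)).
move=> bb; case/survives_succ => [|h|h]; first by rewrite !inE; lia.
- by exists b; left.
- by exists (b + 1); right; split=> //; lia.
Qed.

(** * Dropping the first digit *)

Definition shift b I := if I is T u v s then T u v (b :: s) else T01.

(* Every digit has absolute value at least 2, and the leading digits of both
   endpoints have the sign of [e]. *)
Definition headed e I := if I is T u v s then
    [&& all (fun a => 2 <= `|a|) [:: u, v & s],
        0 < e * head u s & 0 < e * head v s]
  else false.

Lemma headed_splits e I p q J K :
  headed e I -> splits I p q J K -> headed e J && headed e K.
Proof.
move=> + sp; case: sp => //= [b s bin|s|s|s|s]; last first.
1-4: case: s => [|a s] /=; lia.
rewrite !all_rcons; move: bin; rewrite !inE => bin.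
by case: s => [|a s] /=; lia.
Qed.

Lemma headed_descendant e I J : headed e I -> descendant I J -> headed e J.
Proof.
move=> eI; elim=> // K1 p q K2 K3 _ IH sp;
by case/andP: (headed_splits IH sp).
Qed.

Lemma cf_gt1 s z : all (fun a => 2 <= `|a|) s -> 1 < `|z| -> 1 < `|cf s z|.
Proof.
move=> + z1; elim: s => //= a s IH /andP[a2 /IH w1].
have a2' : 2 <= `|a%:~R| :> R by rewrite -intr_norm (ler_int _ 2).
have : `|1 / cf s z| < 1.
  by rewrite div1r normfV invf_lt1 //; apply: lt_trans w1.
by have := lerB_normD (a%:~R : R) (1 / cf s z); lra.
Qed.

(** The leading digit dominates: |a| >= 2, while the rest contributes less than 1 in absolute
    value. *)
Lemma cf_sign e a s z : all (fun a => 2 <= `|a|) (a :: s) -> 1 < `|z| ->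
  0 < e * a -> 0 < e%:~R * cf (a :: s) z.
Proof.
move=> /= /andP[a2 s2] z1 ea; have w1 := cf_gt1 s2 z1.
have : `|1 / cf s z| < 1.
  by rewrite div1r normfV invf_lt1 //; apply: lt_trans w1.
rewrite ltr_norml => /andP[h1 h2].
have [e0|e0] : (0 < e /\ 2 <= a) \/ (e < 0 /\ a <= -2) by nia.
- apply: mulr_gt0; first by rewrite ltr0z; lia.
  by have : 2%:~R <= a%:~R :> R; [rewrite ler_int; lia | lra].
- rewrite nmulr_rgt0; last by rewrite ltrz0; lia.
  by have : a%:~R <= (-2)%:~R :> R; [rewrite ler_int; lia | lra].
Qed.

Lemma headed_gap_sign e I p q J K : headed e I -> splits I p q J K ->
  0 < e%:~R * p /\ 0 < e%:~R * q.
Proof.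
have mu1 : 1 < `|mu : R|.
  by have := mu_inv_bounds; have := mu_eq => *; rewrite gtr0_norm; lra.
move=> + sp; case: sp => //= [b s|s|s|s|s]; first rewrite !inE => bin.
all: move=> /and3P[H h1 h2]; rewrite /Pplus /Pminus; split.
all: case: s H h1 h2 => [|a s] H h1 h2; apply: cf_sign; rewrite ?normrN //=.
all: move: H h1 h2; rewrite ?all_rcons /=; lia.
Qed.

(** Inversion is monotone only on each side of 0, hence the requirement that both endpoints have the
    sign of [e]. *)
Lemma ointerval_shift e b p q y : 0 < e%:~R * p -> 0 < e%:~R * q ->
  ointerval p q y -> ointerval (b%:~R + 1 / p) (b%:~R + 1 / q) (b%:~R + 1 / y).
Proof.
move=> ep eq /ointervalP ypq; apply/ointervalP.
rewrite !ltrD2l !div1r; case: (ltgtP e 0) ep eq => e0; last first.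
- by rewrite e0 mul0r ltxx.
- rewrite !pmulr_rgt0 ?ltr0z // => p0 q0.
  by rewrite !ltf_pV2 ?posrE //; lra.
- rewrite !nmulr_rgt0 ?ltrz0 // => p0 q0.
  by rewrite !ltf_nV2 ?negrE //; lra.
Qed.

(** Prepending [b] to the prefix turns an endpoint p into b + 1 / p by computation. [headed]
    excludes [T01], which [shift] leaves fixed. *)
Lemma splits_shift e b I p q J K : headed e I -> splits I p q J K ->
  splits (shift b I) (b%:~R + 1 / p) (b%:~R + 1 / q) (shift b J) (shift b K).
Proof.
move=> + sp; case: sp => //= [c s cin|s|s|s|s] _.
- exact: (splits_succ R (b :: s) cin).
- exact: (splits_2_5 R (b :: s)).
- exact: (splits_3_5 R (b :: s)).
- exact: (splits_m5_m2 R (b :: s)).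
- exact: (splits_m5_m3 R (b :: s)).
Qed.

Lemma descendant_shift e b I J : headed e I -> descendant I J ->
  descendant (shift b I) (shift b J).
Proof.
move=> eI; elim=> [|K1 p q K2 K3 d IH sp|K1 p q K2 K3 d IH sp].
- exact: descendant_refl.
- exact: descendant_fst IH (splits_shift b (headed_descendant eI d) sp).
- exact: descendant_snd IH (splits_shift b (headed_descendant eI d) sp).
Qed.

Lemma survives_unshift e b I y : headed e I -> interval_set I y ->
  survives (shift b I) (b%:~R + 1 / y) -> survives I y.
Proof.
move=> eI yI [_ xG]; split=> // J IJ [p [q [K [L [sp ypq]]]]].
have eJ := headed_descendant eI IJ.
have [ep eq] := headed_gap_sign eJ sp.
apply: xG (descendant_shift b eI IJ) _.
exists (b%:~R + 1 / p), (b%:~R + 1 / q), (shift b K), (shift b L).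
by split; [apply: splits_shift eJ sp | apply: ointerval_shift ep eq ypq].
Qed.

(** * From an interval with prefix (b) to the next tail *)

Lemma survives_above b x : survives (T 2 5 [:: b]) x ->
  0 < x - b%:~R < 1 / 2 /\ survives (T 2 5 [::]) (1 / (x - b%:~R)).
Proof.
move=> sx; have [xI _] := sx.
have [d dE] : exists d, x = b%:~R + d by exists (x - b%:~R); lra.
move: xI sx; rewrite {}dE addrAC subrr add0r => xI sx.
(* Inverting these bounds gives [2 + 1 / mu, mu], which is T_{2,5} with empty prefix. *)
have : m <= d <= 1 / (2 + m).
  have := mu_inv_bounds; have := inv_2mu_bounds; move: xI.
  rewrite /interval_set /Pplus /Pminus /= !inv_oppmu.
  rewrite digit5_mu.
  by move=> /cintervalP; lra.
have := mu_inv_bounds; have := inv_2mu_bounds => kb wb dI.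
have d0 : 0 < d by lra.
split; first lra.
apply: (@survives_unshift 1 b) => //; last by rewrite !div1r invrK.
rewrite /interval_set /Pplus /Pminus /= inv_oppmu; apply/cintervalP; left.
rewrite digit5_mu.
have m0 : 0 < 2 + m by lra.
have mu0 : 0 < @mu R by have := mu_eq; lra.
case/andP: dI; rewrite ler_pdivrMr // ler_pdivlMr // => h1 h2.
by rewrite ler_pdivlMr // ler_pdivrMr //; lra.
Qed.

Lemma survives_below b x : survives (T (-5) (-2) [:: b]) x ->
  - (1 / 2) < x - b%:~R < 0 /\ survives (T (-5) (-2) [::]) (1 / (x - b%:~R)).
Proof.
move=> sx; have [xI _] := sx.
have [d dE] : exists d, x = b%:~R - d by exists (b%:~R - x); lra.
move: xI sx; rewrite {}dE addrAC subrr add0r => xI sx.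
have : m <= d <= 1 / (2 + m).
  have := mu_inv_bounds; have := inv_2mu_bounds; move: xI.
  rewrite /interval_set /Pplus /Pminus /= !inv_oppmu.
  rewrite digitm2_mu digitm5_mu.
  by rewrite !invrN !mulrN => /cintervalP; lra.
have := mu_inv_bounds; have := inv_2mu_bounds => kb wb dI.
have d0 : 0 < d by lra.
split; first lra.
apply: (@survives_unshift (-1) b) => //; last first.
  by rewrite invrN mulrN !div1r invrN invrK.
rewrite /interval_set /Pplus /Pminus /= inv_oppmu; apply/cintervalP; left.
rewrite digitm5_mu.
have m0 : 0 < 2 + m by lra.
have mu0 : 0 < @mu R by have := mu_eq; lra.
case/andP: dI; rewrite ler_pdivrMr // ler_pdivlMr // => h1 h2.
rewrite invrN mulrN lerN2.
have : 2 + m <= 1 / d by rewrite ler_pdivlMr //; lra.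
have : 1 / d <= mu by rewrite ler_pdivrMr //; lra.
by lra.
Qed.

(** * The nearest-integer step on survivors, and their irrationality *)

Lemma nearest_int_unique x b : `|x - b%:~R| < 1 / 2 -> nearest_int x = b.
Proof.
rewrite ltr_norml => h; apply: floor_def.
by rewrite intrD; lra.
Qed.

Definition nicf_next x : R := 1 / (x - (nearest_int x)%:~R).

Definition survivor x :=
  survives (T 2 5 [::]) x \/ survives (T (-5) (-2) [::]) x.

Lemma survives_above_next b x : survives (T 2 5 [:: b]) x ->
  [/\ nearest_int x = b, 0 < `|x - b%:~R| < 1 / 2 &
      survives (T 2 5 [::]) (nicf_next x)].
Proof.
case/survives_above => xb sx.
have h : 0 < `|x - b%:~R| < 1 / 2 by rewrite gtr0_norm //; lra.
have E : nearest_int x = b by apply: nearest_int_unique; lra.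
by rewrite /nicf_next E.
Qed.

Lemma survives_below_next b x : survives (T (-5) (-2) [:: b]) x ->
  [/\ nearest_int x = b, 0 < `|x - b%:~R| < 1 / 2 &
      survives (T (-5) (-2) [::]) (nicf_next x)].
Proof.
case/survives_below => xb sx.
have h : 0 < `|x - b%:~R| < 1 / 2 by rewrite ltr0_norm //; lra.
have E : nearest_int x = b by apply: nearest_int_unique; lra.
by rewrite /nicf_next E.
Qed.

Lemma survives_pos_digit x : survives (T 2 5 [::]) x -> 0 < nearest_int x.
Proof.
by case/survives_pos=> b [] [bb];
  [case/survives_above_next | case/survives_below_next] => -> _ _; lia.
Qed.

Lemma survives_neg_digit x : survives (T (-5) (-2) [::]) x -> nearest_int x < 0.
Proof.
by case/survives_neg=> b [] [bb];
  [case/survives_above_next | case/survives_below_next] => -> _ _; lia.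
Qed.

Lemma survivor_next x : survivor x ->
  [/\ 0 < `|x - (nearest_int x)%:~R| < 1 / 2, survivor (nicf_next x),
      `|nearest_int x| <= 5 &
      `|nearest_int x| = 5 ->
        sgz (nearest_int (nicf_next x)) = - sgz (nearest_int x)].
Proof.
case=> [/survives_pos|/survives_neg]
  [b [[bb /survives_above_next[-> xb sx]]|[bb /survives_below_next[-> xb sx]]]].
all: split=> //; [by [left|right] | lia |].
(* When the next tail keeps the sign of the digit, the range of [b] excludes |b| = 5; otherwise the
   next digit has the opposite sign. *)
all: try move: (survives_pos_digit sx); try (move: (survives_neg_digit sx)).
all: lia.
Qed.

(* If [x = p / q] then [nicf_next x = q / (p - a q)] with
   [|p - a q| <= |q| / 2], so the denominators would decrease forever. *)
Lemma survivor_not_quotient n x (p q : int) :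
  q != 0 -> (`|q| <= n)%N -> x * q%:~R = p%:~R -> ~ survivor x.
Proof.
elim: n x p q => [|n IH] x p q q0 qn xq sx; first by move: qn q0; lia.
have [xa sx' _ _] := survivor_next sx; move: xa sx'; rewrite /nicf_next.
set a := nearest_int x; set d := x - a%:~R => /andP[d0 d2] sx'.
have pE : (p - a * q)%:~R = d * q%:~R.
  by rewrite intrB intrM -xq mulrBl.
have q0' : q%:~R != 0 :> R by rewrite intr_eq0.
have d0' : d != 0 by rewrite -normr_gt0.
apply: (IH (1 / d) q (p - a * q)) => //.
- by rewrite -(intr_eq0 R) pE mulf_neq0.
- suff : `|p - a * q| < `|q| by lia.
  rewrite -(ltr_int R) !intr_norm pE normrM gtr_pMl ?normr_gt0 //; lra.
- by rewrite pE mulrA divfK // mul1r.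
Qed.

Lemma survivor_irrational x : survivor x -> irrational x.
Proof.
move=> sx [r _ rx].
apply: (@survivor_not_quotient `|denq r|%N x (numq r) (denq r)) => //.
by rewrite -rx -!(ratr_int R) -rmorphM /= -numqE.
Qed.

(** * Points of the Cantor set *)

Lemma C_NICF_first x : C_NICF R x ->
  0 < `|x - (nearest_int x)%:~R| /\ survivor (nicf_next x).
Proof.
move/C_NICF_survives/survives_T01.
case=> [/survives_above_next|/survives_below_next] [-> /andP[h _] sx].
- by split=> //; left.
- by split=> //; right.
Qed.

(** The index starts at 1: x_0 lies in [0, 1], whereas survivors have absolute value above 2. *)
Lemma C_NICF_tail x i : C_NICF R x ->
  exists2 y, nicf_tail x i.+1 = Some y & survivor y.
Proof.
move=> /C_NICF_first[x0 sx]; elim: i => [|i [y yE sy]].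
  exists (nicf_next x) => //=.
  by move: x0; rewrite normr_gt0 subr_eq0 => /negPf ->.
have [/andP[y0 _] sy' _ _] := survivor_next sy.
exists (nicf_next y) => //; rewrite [LHS]/= -/(nicf_tail x i.+1) yE.
by move: y0; rewrite normr_gt0 subr_eq0 => /negPf ->.
Qed.

(** If x were rational, so would be the tail x_1, which is a survivor. *)
Lemma C_NICF_irrational x : C_NICF R x -> irrational x.
Proof.
move=> /C_NICF_first[_ /survivor_irrational xQ] [r _ rx]; apply: xQ.
exists (1 / (r - (nearest_int x)%:~R)) => //.
by rewrite /nicf_next !div1r fmorphV rmorphB /= ratr_int rx.
Qed.

Lemma C_NICF_NICF5star x : C_NICF R x -> NICF5star R x.
Proof.
move=> Cx; split.
  have [/cintervalP] := Cx.
  by have := mu_inv_bounds; lra.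
case=> // i a _; have [y yE sy] := C_NICF_tail i Cx.
have [/andP[y0 _] _ a5 aS] := survivor_next sy.
rewrite /nicf_digit yE => -[<-]; split=> // /aS <- b.
rewrite [nicf_tail x i.+2]/= -/(nicf_tail x i.+1) yE.
by move: y0; rewrite normr_gt0 subr_eq0 => /negPf -> [<-].
Qed.

End Survivors.

Theorem theorem5p6 (R : realType) : C_NICF R `<=` NICF5star R `\` rational.
Proof.
by move=> x Cx; split; [apply: C_NICF_NICF5star | apply: C_NICF_irrational].
Qed.
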